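(* Let $n=2r+1\ge 5$. Let $\mathcal H$ be a simple $n$-vertex hypergraph containing a Hamiltonian Berge cycle $C=v_0e_0v_1e_1\cdots v_{n-1}e_{n-1}v_0$. Let $\mathcal G\subseteq E(\mathcal H)$ satisfy $E(C)\subseteq\mathcal G$, and suppose that every hyperedge in $\mathcal G$ has size at least $r$. If $D\subseteq\{2,\dots,r\}$ and $|\mathcal G|\ge n+|D|$, then there is a Hamiltonian Berge cycle $C_D$ with the same vertex sequence $v_0,v_1,\dots,v_{n-1}$ and with edge set contained in $\mathcal G$, together with distinct hyperedges $g_d\in\mathcal G\setminus E(C_D)$, one for each $d\in D$, such that $g_d$ realizes cyclic distance $d$.
   Context: All hypergraphs are finite and simple: the edge family consists of distinct subsets of the vertex set. A Berge cycle of length $\ell\ge 2$ is an alternating sequence $x_0h_0x_1h_1\cdots x_{\ell-1}h_{\ell-1}x_0$ with distinct vertices $x_i$, distinct hyperedges $h_i$, and $\{x_i,x_{i+1}\}\subseteq h_i$ for every $i$ (indices modulo $\ell$); its edge set is $E(C)=\{h_0,\dots,h_{\ell-1}\}$. It is Hamiltonian if it contains every vertex. Relative to the displayed cyclic order $v_0,\dots,v_{n-1}$, a hyperedge $h$ realizes cyclic distance $d$ if it contains a pair $\{v_i,v_{i+d}\}$ for some $i$ (indices modulo $n$). *)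

(* Defs.v *)
From mathcomp Require Import all_boot.

Set Implicit Arguments.
Unset Strict Implicit.
Unset Printing Implicit Defensive.

(* A simple hypergraph with vertex set the finType V is its set of hyperedges,
   of type {set {set V}}. *)
Section BergeCycles.

Variable V : finType.

(* The sequence x_0 h_0 x_1 h_1 ... x_(l-1) h_(l-1) x_0; ordS is the successor
   modulo l. *)
Definition berge_cycle (H : {set {set V}}) (l : nat)
    (x : 'I_l -> V) (h : 'I_l -> {set V}) : Prop :=
  [/\ 2 <= l, injective x, injective h, (forall i, h i \in H)
    & forall i, [set x i; x (ordS i)] \subset h i].

Definition cycle_edges (l : nat) (h : 'I_l -> {set V}) : {set {set V}} :=
  [set h i | i : 'I_l].

Definition hamiltonian_berge_cycle (H : {set {set V}}) (l : nat)
    (x : 'I_l -> V) (h : 'I_l -> {set V}) : Prop :=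
  berge_cycle H x h /\ forall u : V, exists i, x i = u.

Definition realizes_distance (n : nat) (v : 'I_n -> V) (h : {set V}) (d : nat)
    : Prop :=
  exists i j : 'I_n, j = i + d %[mod n] /\ [set v i; v j] \subset h.

End BergeCycles.

(* Main.v *)
(* Let n = 2r+1. A set of at least r residues mod n without difference d is
   {x+d, x+3d, ..., x+(2r-1)d} for some x, with d a generator of Z/n; it has
   every difference other than d and -d. So a hyperedge of G misses at most
   one distance, and contains a consecutive pair v_i, v_(i+1) whose position i
   is x plus a constant depending only on d. The hyperedges of G off the cycle
   represent D injectively unless all of them miss the same d in D. In that
   case, insert one of them in the cycle at its position i; the hyperedge it
   replaces, if it misses d too, is inserted at its own position, and so on.
   Distinct hyperedges have distinct positions, so this ends by releasing
   a hyperedge that realizes d, while all other unused ones still miss d and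
   thus realize the rest of D. *)

Require Import Defs.
From mathcomp Require Import all_boot.
From mathcomp Require Import fingroup perm ssralg finalg zmodp cyclic zify.

Set Implicit Arguments.
Unset Strict Implicit.
Unset Printing Implicit Defensive.

Import GRing.Theory FinRing.Theory.

(** * Large difference-avoiding sets in a finite abelian group of odd order *)

Section DifferenceAvoidingSets.

Local Open Scope ring_scope.

Variable Z : finZmodType.
Implicit Types (d e x y : Z) (S : {set Z}).

Definition avoids d S := [forall x in S, x + d \notin S].

(** For odd [#|Z|] the parity rule does not close up: the indices [0] and [#|Z| - 1] are both even,
    so [x] and [x - d] are both outside [S]. *)
Definition alternates d x S :=
  forall k, (k < #|Z|)%N -> (x + d *+ k \in S) = odd k.

Lemma mulrn_card x : x *+ #|Z| = 0.
Proof. by rewrite -zmodXgE -cardsT expg_cardG ?inE. Qed.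

Hypothesis oddZ : odd #|Z|.

(** [S] and its translate by [d] are disjoint and of equal size, so by parity exactly one point [x]
    lies outside both. *)
Lemma avoids_flip d S : avoids d S -> (#|Z| <= (#|S|.*2).+1)%N ->
  exists2 x, x \notin S /\ x - d \notin S &
    forall y, y != x -> (y \in S) = (y - d \notin S).
Proof.
move=> /forall_inP avS leS.
pose S' := [set y + d | y in S].
have cS' : #|S'| = #|S| by rewrite card_imset //; apply: addIr.
have inS' y : (y \in S') = (y - d \in S).
  apply/imsetP/idP => [[z zS ->]|yS]; first by rewrite addrK.
  by exists (y - d) => //; rewrite subrK.
have dis : [disjoint S & S'].
  rewrite disjoint_subset; apply/subsetP => y yS; rewrite !inE inS'.
  by apply/negP => /avS; rewrite subrK yS.
have cU : #|S :|: S'| = #|S|.*2.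
  by rewrite cardsU disjoint_setI0 // cards0 subn0 cS' addnn.
have cC : #|~: (S :|: S')| = 1%N.
  have := cardsC (S :|: S'); rewrite cU => eZ.
  move: leS oddZ; rewrite -eZ oddD odd_double /= -addn1 leq_add2l.
  by case: #|_| => [|[|]].
have /cards1P[x xE] : #|~: (S :|: S')| == 1%N by rewrite cC.
have xP y : (y == x) = (y \notin S) && (y - d \notin S).
  by rewrite -in_set1 -xE !inE inS' negb_or.
exists x => [|y yx]; first by apply/andP; rewrite -xP.
move: yx; rewrite xP; case: (boolP (y \in S)) => [yS _|_ /=].
  by apply/esym/negP=> /avS; rewrite subrK yS.
by rewrite negbK => ->.
Qed.

(* Off the exceptional point x, adding d toggles membership in S; a coset of
   <d> missing x would thus be an odd cycle alternating in and out of S. *)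
Lemma avoids_alternates d S : avoids d S -> (#|Z| <= (#|S|.*2).+1)%N ->
  exists2 x, alternates d x S &
    forall y, exists2 k, (k < #|Z|)%N & y = d *+ k.
Proof.
move=> avS leS; have [x [xS xdS] flip] := avoids_flip avS leS.
have flip' y : y + d != x -> (y + d \in S) = (y \notin S).
  by move=> /flip ->; rewrite addrK.
have gen0 y : exists k : 'I_#|Z|, y + d *+ k == x.
  apply/existsP; apply: contraT; rewrite negb_exists => /forallP nx.
  have Z0 : (0 < #|Z|)%N by case: #|Z| oddZ.
  have alt k : (k <= #|Z|)%N -> (y + d *+ k \in S) = (y \in S) (+) odd k.
    elim: k => [|k IH] lek; first by rewrite mulr0n addr0 addbF.
    rewrite mulrSr addrA flip' ?IH 1?ltnW // ?addbN //.
    rewrite -addrA -mulrSr; move: lek; rewrite leq_eqVlt => /predU1P[->|ltk].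
      by rewrite mulrn_card -[0](mulr0n d); apply: (nx (Ordinal Z0)).
    exact: (nx (Ordinal ltk)).
  by have := alt _ (leqnn _); rewrite mulrn_card addr0 oddZ; case: (y \in S).
have gen y : exists2 k, (k < #|Z|)%N & y = d *+ k.
  have [k /eqP yx] := gen0 (x - y).
  exists k => //; apply: (addrI (x - y)).
  by rewrite yx subrK.
exists x => //.
(* Surjective between sets of equal size, [f] is injective, so the walk from [x] does not return to
   [x] in fewer than [#|Z|] steps. *)
pose f (k : 'I_#|Z|) := d *+ k.
have /image_injP injf : #|image f predT| == #|{: 'I_#|Z|}|.
  rewrite card_ord; apply/eqP/eq_card => y; rewrite [RHS]inE.
  by have [k ltk ->] := gen y; apply/imageP; exists (Ordinal ltk).
elim=> [|k IH] ltk; first by rewrite mulr0n addr0 (negbTE xS).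
rewrite mulrSr addrA flip' ?IH 1?ltnW //.
rewrite -addrA -mulrSr; apply/negP; rewrite -subr_eq0 addrAC subrr add0r.
have Z0 : (0 < #|Z|)%N by apply: leq_ltn_trans ltk.
move=> /eqP dk; have := injf (Ordinal ltk) (Ordinal Z0) isT isT.
by rewrite /f dk => /(_ erefl).
Qed.

Lemma alternates_inj d x S T :
    (forall y, exists2 k, (k < #|Z|)%N & y = d *+ k) ->
  alternates d x S -> alternates d x T -> S = T.
Proof.
move=> gen aS aT; apply/setP=> y.
have [k ltk yE] := gen (y - x).
by rewrite -(subrK x y) addrC yE aS // aT.
Qed.

(** With [e = d *+ k], the exclusions on [e] give [1 < k < #|Z| - 1], which leaves room for two odd
    indices that differ by [k] modulo [#|Z|]. *)
Lemma alternates_pair d e :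
    (forall y, exists2 k, (k < #|Z|)%N & y = d *+ k) ->
    e != 0 -> e != d -> e != - d ->
  exists c, forall x S, alternates d x S -> x + c \in S /\ x + c + e \in S.
Proof.
move=> gen e0 ed eNd; have [k ltk eE] := gen e.
have k0 : (1 < k)%N.
  by move: e0 ed; rewrite eE; case: k {ltk eE} => [|[|k]] //; rewrite ?mulr0n ?mulr1n eqxx.
have kN : (k.+1 < #|Z|)%N.
  rewrite ltn_neqAle ltk andbT; apply: contra eNd => /eqP kZ.
  by rewrite eE -subr_eq0 opprK -mulrSr kZ mulrn_card.
case: (boolP (odd k)) => ok.
  (* An odd [k] changes parity unless the index wraps around: [#|Z| - k + 1] is odd and goes to
     [#|Z| + 1], that is, to [1]. *)
  exists (d *+ (#|Z| - k).+1) => x S aS; split.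
    rewrite aS; first by rewrite /= oddB 1?ltnW // oddZ ok.
    by lia.
  rewrite -addrA eE -mulrnDr addSn subnK 1?ltnW // mulrSr mulrn_card add0r.
  by rewrite -(mulr1n d) aS // (leq_trans _ kN).
exists d => x S aS; split.
  by rewrite -{1}(mulr1n d) aS // (leq_trans _ kN).
by rewrite -addrA eE -mulrS aS /= ?ok.
Qed.

Lemma avoids_pair d e S : avoids d S -> (#|Z| <= (#|S|.*2).+1)%N ->
  e != 0 -> e != d -> e != - d -> ~~ avoids e S.
Proof.
move=> avS leS e0 ed eNd; have [x aS gen] := avoids_alternates avS leS.
have [c /(_ x S aS)[xS xeS]] := alternates_pair gen e0 ed eNd.
by apply/negP=> /forall_inP/(_ _ xS); rewrite xeS.
Qed.

(* p S is a translate, by a constant depending only on d and e, of the point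
   from which S alternates. *)
Lemma avoids_pair_inj d e : e != 0 -> e != d -> e != - d ->
  exists p : {set Z} -> Z,
    let F := [pred S | avoids d S & (#|Z| <= (#|S|.*2).+1)%N] in
    {in F &, injective p} /\ {in F, forall S, p S \in S /\ p S + e \in S}.
Proof.
move=> e0 ed eNd /=; set F := [pred S | _ & _].
(* That [d] generates the group is learnt from a member of [F]; if there is none, any [p] will
   do. *)
case: (pickP F) => [S0 /andP[av0 le0]|F0]; last first.
  have nF S : S \in F -> False by move=> /= SF; have := F0 S; rewrite /= [_ && _]SF.
  by exists (fun=> 0); split=> [S T /nF|S /nF].
have [_ _ gen] := avoids_alternates av0 le0.
have [c cP] := alternates_pair gen e0 ed eNd.
pose alt x S := [forall k : 'I_#|Z|, (x + d *+ k \in S) == odd k].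
have altP x S : reflect (alternates d x S) (alt x S).
  apply: (iffP forallP) => [a k ltk|a k]; last exact/eqP/a.
  exact/eqP/(a (Ordinal ltk)).
pose q S := odflt 0 [pick x | alt x S].
have qP S : S \in F -> alternates d (q S) S.
  move=> /andP[avS leS]; rewrite /q; case: pickP => [x /altP //|nx].
  by have [x /altP] := avoids_alternates avS leS; rewrite nx.
exists (fun S => q S + c); split=> [S T SF TF /addIr qE|S SF]; last exact/cP/qP.
by apply: (alternates_inj gen (qP S SF)); rewrite qE; apply: qP.
Qed.

End DifferenceAvoidingSets.

(** * Exchange arguments for systems of representatives *)

Section Representatives.

Variable T : finType.

(* Among injections D -> X, a wrong value g d0 suits every other index, so
   exchanging it with a value suiting d0 creates no new wrong one. *)
Lemma injective_choice (I : finType) (D : {set I}) (X : {set T})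
    (R : I -> pred T) (t0 : T) : #|D| <= #|X| ->
    (forall d, d \in D -> exists2 x, x \in X & R d x) ->
    (forall x d d', x \in X -> d \in D -> d' \in D -> d != d' ->
      R d x || R d' x) ->
  exists g : I -> T, {in D &, injective g} /\
    forall d, d \in D -> g d \in X /\ R d (g d).
Proof.
move=> leDX exR oneR.
pose P (g : {ffun I -> T}) := dinjectiveb g D && [forall d in D, g d \in X].
pose g0 := [ffun d => nth t0 (enum X) (index d (enum D))].
have ltD d : d \in D -> index d (enum D) < size (enum X).
  by move=> dD; rewrite -cardE (leq_trans _ leDX) // cardE index_mem mem_enum.
have Pg0 : P g0.
  apply/andP; split; last first.
    by apply/forall_inP=> d dD; rewrite ffunE -mem_enum mem_nth ?ltD.
  apply/dinjectiveP=> d d' dD d'D; rewrite !ffunE => /eqP.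
  rewrite nth_uniq ?ltD ?enum_uniq // => /eqP/(congr1 (nth d (enum D))).
  by rewrite !nth_index ?mem_enum.
case: (arg_maxnP (fun g : {ffun I -> T} => #|[set d in D | R d (g d)]|) Pg0).
move=> g /andP[/dinjectiveP injg /forall_inP gX] maxg.
exists g; split=> // d0 d0D; split; first exact: gX.
apply: contraT => nR0; have [x xX Rx] := exR _ d0D.
(* The transposition keeps [g'] injective whether or not [x] is already a value of [g]. *)
pose g' := [ffun d => tperm (g d0) x (g d)].
have inX d : d \in D -> g' d \in X.
  by move=> dD; rewrite ffunE; case: tpermP => // *; apply: gX.
have Pg' : P g'.
  apply/andP; split; last exact/forall_inP.
  apply/dinjectiveP=> d d' dD d'D; rewrite !ffunE => /perm_inj.
  exact: injg.
have := maxg _ Pg'; rewrite /= leqNgt => /negP[]; apply: proper_card.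
apply/properP; split; last first.
  by exists d0; rewrite !inE ?(negbTE nR0) ?andbF // ffunE tpermL d0D.
apply/subsetP=> d; rewrite !inE ffunE => /andP[dD Rd]; rewrite dD /=.
case: tpermP => [/injg gE|gE|//]; first by rewrite -gE ?Rd // in nR0.
have := oneR _ _ d (gX _ d0D) d0D dD; rewrite (negbTE nR0); apply.
by apply: contraNneq nR0 => ->.
Qed.

Variables (I : finType) (G : {set T}) (ok : I -> pred T).

(** When [ok i h] says that [h] contains the vertices at positions [i] and [i + 1], these are the
    Berge cycles on the fixed vertex sequence with edges in [G]. *)
Definition representatives (f : I -> T) :=
  injective f /\ forall i, f i \in G /\ ok i (f i).

Definition unused (f : I -> T) := G :\: [set f i | i : I].

(* Inserting an unused member of M at the position prescribed by p increases
   the number of members of M sitting at their prescribed position, so after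
   finitely many insertions a non-member of M is expelled. *)
Lemma expel_nonmember (M : pred T) (p : T -> I) (f : I -> T) :
    {in [pred h in G | M h] &, injective p} ->
    (forall h, h \in G -> M h -> ok (p h) h) ->
    representatives f ->
    (exists h, h \in unused f) -> {in unused f, forall h, M h} ->
  exists2 f', representatives f' & exists y, [/\ y \in unused f', ~~ M y &
    {in unused f', forall z, z != y -> M z}].
Proof.
move=> injp okp.
pose placed f := [set i | M (f i) && (p (f i) == i)].
have [k] : exists k, #|I| < #|placed f| + k.
  by exists #|I|.+1; rewrite addnS ltnS leq_addl.
elim: k f => [|k IH] f ltk [injf okf] [h hX] MX.
  by have := max_card (placed f); rewrite leqNgt -[#|placed f|]addn0 ltk.
have Mh := MX h hX; move: (hX); rewrite inE => /andP[hf hG].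
have nhf i : f i != h by apply: contraNneq hf => <-; apply: imset_f.
pose f' i := if i == p h then h else f i.
have repf' : representatives f'.
  split=> [i j|i]; last first.
    by rewrite /f'; case: eqP => [->|_]; [split=> //; apply: okp|apply: okf].
  rewrite /f'; case: eqP => [->|_]; case: eqP => [->|_] //.
  - by move/esym/eqP; rewrite (negbTE (nhf _)).
  - by move/eqP; rewrite (negbTE (nhf _)).
  - exact: injf.
pose y := f (p h).
have yX : y \in unused f'.
  rewrite !inE (proj1 (okf _)) andbT; apply/imsetP=> -[i _].
  rewrite /f'; case: eqP => [_ /eqP|ne /injf /esym //].
  by rewrite (negbTE (nhf _)).
have X'M z : z \in unused f' -> z != y -> M z.
  rewrite !inE => /andP[zf' zG] zy; apply: MX; rewrite !inE zG andbT.
  apply: contra zf' => /imsetP[i _ zE]; apply/imsetP; exists i => //.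
  by rewrite /f'; case: eqP zE => // -> zE; rewrite zE eqxx in zy.
have [My|nMy] := boolP (M y); last by exists f' => //; exists y.
apply: (IH f') => //; first last.
- by move=> z zX; have [->|/(X'M z zX)] := eqVneq z y.
- by exists y.
rewrite (leq_trans ltk) // addnS -addSn leq_add2r; apply: proper_card.
(* Position [p h] is newly placed: a former occupant in [M] placed there would equal [h] by
   injectivity of [p]. *)
apply/properP; split; last first.
  exists (p h); first by rewrite inE /f' eqxx Mh eqxx.
  rewrite inE; apply/negP=> /andP[Mfh /eqP/injp fh].
  have /eqP := fh (introT andP (conj (proj1 (okf _)) Mfh)) (introT andP (conj hG Mh)).
  by rewrite (negbTE (nhf _)).
apply/subsetP=> i; rewrite !inE /f' => /andP[Mi /eqP pi].
case: eqP => [iE|_]; last by rewrite Mi pi /=.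
have /eqP := injp (f i) h (introT andP (conj (proj1 (okf _)) Mi))
  (introT andP (conj hG Mh)) (etrans pi iE).
by rewrite (negbTE (nhf _)).
Qed.

End Representatives.

(** * Vertices read as residues modulo n *)

Section CyclicDistances.

Variables (m : nat) (V : finType) (v : 'I_m.+1 -> V).
Hypotheses (injv : injective v) (surv : forall u, exists i, v i = u).

Lemma card_preim_vertices (h : {set V}) : #|v @^-1: h| = #|h|.
Proof.
apply: on_card_preimset; apply: onW_bij; apply: inj_card_bij => //.
rewrite -(card_codom injv); apply/subset_leq_card/subsetP => u _.
by have [i <-] := surv u; apply: codom_f.
Qed.

Lemma preim_vertices_inj : injective (fun h : {set V} => v @^-1: h).
Proof.
move=> h h' /setP hE; apply/setP => u; have [i <-] := surv u.
by have := hE i; rewrite !inE.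
Qed.

Lemma ordS_addr (i : 'I_m.+1) : ordS i = (i + inZp 1)%R.
Proof. by apply: val_inj; rewrite /= modnDmr addn1. Qed.

Lemma realizes_avoids (h : {set V}) (d : nat) :
  ~~ avoids (inZp d) (v @^-1: h) -> realizes_distance v h d.
Proof.
rewrite negb_forall_in => /exists_inP[i]; rewrite !inE negbK => ih jh.
exists i, (i + inZp d)%R; split; first by rewrite /= modn_mod modnDmr.
by apply/subsetP=> u; rewrite !inE => /orP[]/eqP->.
Qed.

(** Since [0 < d + d' < m.+1], not even a change of sign identifies the two classes. *)
Lemma inZp_distance (r d d' : nat) : m = r.*2 -> 0 < d <= r -> 0 < d' <= r ->
  d != d' -> [/\ inZp d != 0%R :> 'I_m.+1, inZp d != inZp d' :> 'I_m.+1
    & inZp d != (- inZp d')%R :> 'I_m.+1].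
Proof.
move=> mr dr d'r dd'; rewrite -!val_eqE /=.
have -> : d %% m.+1 = d by apply: modn_small; lia.
have -> : d' %% m.+1 = d' by apply: modn_small; lia.
have -> : (m.+1 - d') %% m.+1 = m.+1 - d' by apply: modn_small; lia.
by split; lia.
Qed.

End CyclicDistances.

Theorem theorem1p3 (r n : nat) (hn : n = 2 * r + 1) (hn5 : 5 <= n)
    (V : finType) (hV : #|V| = n) (H : {set {set V}})
    (v : 'I_n -> V) (e : 'I_n -> {set V})
    (hC : hamiltonian_berge_cycle H v e)
    (G : {set {set V}}) (hGH : G \subset H)
    (hCG : cycle_edges e \subset G)
    (hGr : forall h, h \in G -> r <= #|h|)
    (D : {set 'I_r.+1}) (hD : forall d, d \in D -> 2 <= d)
    (hGD : n + #|D| <= #|G|) :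
  exists f : 'I_n -> {set V},
    [/\ hamiltonian_berge_cycle H v f,
        cycle_edges f \subset G
      & exists g : 'I_r.+1 -> {set V},
          {in D &, injective g} /\
          forall d, d \in D ->
            g d \in G :\: cycle_edges f /\ realizes_distance v (g d) d].
Proof.
have {}hn : n = r.*2.+1 by rewrite hn mul2n addn1.
case: n => // m in hn hn5 hV v e hC hCG hGD *.
case: hn => mr.
have [[n2 injv inje eH eok] surv] := hC.
pose ok (i : 'I_m.+1) (h : {set V}) := [set v i; v (ordS i)] \subset h.
pose miss (d : 'I_r.+1) (h : {set V}) := avoids (inZp d) (v @^-1: h).
have hDr (d : 'I_r.+1) : d \in D -> 0 < d <= r.
  by move=> /hD/ltnW->; rewrite -ltnS ltn_ord.
have oddZ : odd #|'I_m.+1| by rewrite card_ord mr /= odd_double.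
have large h : h \in G -> #|'I_m.+1| <= (#|v @^-1: h|.*2).+1.
  by move=> /hGr; rewrite card_preim_vertices // card_ord mr ltnS leq_double.
have cX f : representatives G ok f -> #|D| <= #|unused G f|.
  move=> [injf fG]; have := cardsID (cycle_edges f) G.
  rewrite (setIidPr _); last by apply/subsetP => h /imsetP[i _ ->]; case: (fG i).
  by rewrite card_imset // card_ord => cG; move: hGD; rewrite -cG leq_add2l.
have one h d d' : h \in G -> d \in D -> d' \in D -> d != d' ->
    ~~ miss d h || ~~ miss d' h.
  move=> hG dD d'D dd'; rewrite orbC -implybE; apply/implyP => av.
  have [d0 d1 d2] := inZp_distance mr (hDr _ dD) (hDr _ d'D) dd'.
  by apply: (avoids_pair oddZ av (large _ hG)).
suff [f repf realf] : exists2 f, representatives G ok f &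
    forall d, d \in D -> exists2 h, h \in unused G f & ~~ miss d h.
  have [injf fGok] := repf; exists f; split.
  - split=> //; split=> // i; last by case: (fGok i).
    by apply: (subsetP hGH); case: (fGok i).
  - by apply/subsetP => h /imsetP[i _ ->]; case: (fGok i).
  have [|g [injg gP]] := injective_choice (set0 : {set V}) (cX f repf) realf.
    by move=> h d d'; case/setDP=> hG _; apply: one.
  exists g; split=> // d dD; have [gX nmiss] := gP d dD.
  by split; last exact: realizes_avoids.
have repe : representatives G ok e.
  by split=> // i; split; [apply/(subsetP hCG)/imset_f|apply: eok].
have [/forall_inP all|] :=
  boolP [forall d in D, [exists h in unused G e, ~~ miss d h]].
  by exists e => // d /all/exists_inP.
rewrite negb_forall_in => /exists_inP[d dD].
rewrite negb_exists_in => /forall_inP missd.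
have Xmiss : {in unused G e, forall h, miss d h}.
  by move=> h /missd; rewrite negbK.
(* Consecutive vertices are at distance 1, which differs from [d] because [d] is at least 2. *)
have d1 : 0 < 1 <= r by lia.
have [|e0 ed eNd] := inZp_distance mr d1 (hDr _ dD); first by have := hD _ dD; lia.
have [p [injp pP]] := avoids_pair_inj oddZ e0 ed eNd.
have inF h : h \in [pred h in G | miss d h] -> v @^-1: h \in
    [pred S | avoids (inZp d) S & #|'I_m.+1| <= (#|S|.*2).+1].
  by case/andP=> hG Mh; apply/andP; split; last exact: large.
have [|||||f repf [y [yX nMy XM]]] :=
    @expel_nonmember _ _ G ok (miss d) (fun h => p (v @^-1: h)) e.
- by move=> h h' hM h'M /(injp _ _ (inF _ hM) (inF _ h'M))/preim_vertices_inj; apply.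
- move=> h hG Mh; have [] := pP _ (inF h (introT andP (conj hG Mh))).
  rewrite !inE => ph pSh; apply/subsetP=> u; rewrite !inE ordS_addr.
  by case/orP=> /eqP->.
- exact: repe.
- by apply/card_gt0P; apply: leq_trans (cX e repe); apply/card_gt0P; exists d.
- exact: Xmiss.
exists f => // d' d'D; have [->|dd'] := eqVneq d' d; first by exists y.
have /card_gt1P[z [z' [zX z'X zz']]] : 1 < #|unused G f|.
  apply: leq_trans (cX f repf); apply/card_gt1P.
  by exists d', d; rewrite d'D dD.
have [w wX wy] : exists2 w, w \in unused G f & w != y.
  have [zy|] := eqVneq z y; last by exists z.
  by exists z' => //; rewrite -zy eq_sym.
exists w => //; have wG : w \in G by case/setDP: wX.
by have := one w d' d wG d'D dD dd'; rewrite (XM w wX wy) orbF.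
Qed.
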